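(* For every integer $d\ge 1$, \[ \alpha_3(d)= \begin{cases} 3,&d=2,\\ 6,&d=4,\\ \displaystyle\left\lceil\frac{(d+1)(d+2)}6\right\rceil,&d\notin\{2,4\}. \end{cases} \]
   Context: For integers $q\ge 2$, $d\ge 0$, let $\Delta_q(d)=\{a\in\mathbb Z_{\ge0}^q:\sum_{i=1}^q a_i=d\}$, and let $e_1,\dots,e_q$ be the standard unit vectors of $\mathbb Z^q$. The graph $G_q(d)$ has vertex set $\Delta_q(d)$; distinct $a,b\in\Delta_q(d)$ are adjacent exactly when $a-b=e_i-e_j$ for some $i\ne j$. Write $\alpha_q(d)=\alpha(G_q(d))$ for its independence number. *)

(* Defs.v *)
From mathcomp Require Import all_boot all_order all_algebra.

Set Implicit Arguments.
Unset Strict Implicit.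
Unset Printing Implicit Defensive.

Import Order.TTheory GRing.Theory Num.Theory.
Local Open Scope ring_scope.

Section Graph.
Variables (T : finType) (e : rel T).

Definition independent (A : {set T}) : bool :=
  [forall x in A, forall y in A, ~~ e x y].

Definition independence_number : nat :=
  \max_(A : {set T} | independent A) #|A|.

End Graph.

(* The coordinates of a vector of nonnegative integers with sum d are at most d,
   so bounding them by d loses no vector and makes the vertex type finite. *)
Definition simplex (q d : nat) : finType :=
  {a : {ffun 'I_q -> 'I_d.+1} | (\sum_(i < q) a i)%N == d}.

Definition vec (q d : nat) (a : simplex q d) : 'rV[int]_q :=
  \row_(i < q) (val a i)%:Z.

Definition unit_vec (q : nat) (i : 'I_q) : 'rV[int]_q := delta_mx 0 i.

Definition adj (q d : nat) : rel (simplex q d) := fun a b =>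
  (a != b) &&
  [exists i : 'I_q, exists j : 'I_q,
    (i != j) && (vec a - vec b == unit_vec i - unit_vec j)].

Definition alpha (q d : nat) : nat := independence_number (@adj q d).

(* Main.v *)
Require Import Defs.
From mathcomp Require Import all_boot all_order all_algebra.
From mathcomp Require Import zify.
Import Order.TTheory GRing.Theory Num.Theory.
Local Open Scope ring_scope.

(* Project Delta_3(d) to the lattice triangle T_n = {(x, y) : x + y < n} with
   n = d + 1; the maximal cliques become the unit triangles of the two
   orientations, and an independent set meets each of them at most once.
   Lower bound: the colour classes of x + 2y mod 3 are independent and one of
   them contains at least a third of the points; for d = 2 and d = 4 the points
   with even coordinates do better.
   Upper bound: T_(a+b) is the disjoint union of copies of T_a, T_b and an
   a x b rhombus, and the rhombus is tiled by unit triangles when 3 | a and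
   2 | b.  Starting from T_6 and T_9 and adding copies of T_6 yields the bound
   for all T_(3k) with k != 1; adding one copy of T_2 or T_4 reaches the other
   residues of n mod 3, except that T_1 and T_7 are treated directly.  An exact
   tiling of T_6 by triangles does not exist, so a double cover is used. *)

Local Open Scope nat_scope.

(** * Packings of unit triangles and the splitting of T_n *)

(** The two inequalities belong to the upward and the downward unit triangle of the cell at (x,
    y). *)
Definition triangle_packing (f : nat -> nat -> nat) : Prop :=
  forall x y, f x y + f x.+1 y + f x y.+1 <= 1 /\
              f x.+1 y + f x y.+1 + f x.+1 y.+1 <= 1.

Definition triangle_sum (f : nat -> nat -> nat) (n : nat) : nat :=
  \sum_(0 <= x < n) \sum_(0 <= y < n - x) f x y.

Lemma triangle_packing_shift f a b :
  triangle_packing f -> triangle_packing (fun x y => f (a + x) (b + y)).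
Proof. by move=> pf x y; have := pf (a + x) (b + y); rewrite !addnS. Qed.

(** The points with x >= a form a copy of T_b; those with x < a form the rhombus where y < b and a
    copy of T_a where y >= b. *)
Lemma triangle_sum_split f a b :
  triangle_sum f (a + b) =
  triangle_sum (fun x y => f x (b + y)) a +
  triangle_sum (fun x y => f (a + x) y) b +
  \sum_(0 <= x < a) \sum_(0 <= y < b) f x y.
Proof.
rewrite /triangle_sum (big_cat_nat _ (leq_addr b a)) //= addnAC; congr (_ + _).
  rewrite -big_split /= big_nat [RHS]big_nat; apply: eq_bigr => x /andP[_ ltxa].
  have leb : b <= a + b - x by lia.
  rewrite (big_cat_nat _ leb) //= addnC; congr (_ + _).
  rewrite -{1}[b]add0n big_addn; have -> : a + b - x - b = a - x by lia.
  by apply: eq_bigr => y _; rewrite addnC.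
rewrite -{1}[a]add0n big_addn addKn; apply: eq_bigr => x _.
rewrite [X in _ - X]addnC subnDl.
by apply: eq_bigr => y _; rewrite addnC.
Qed.

Lemma rhombus_sum_le f k m : triangle_packing f ->
  \sum_(0 <= x < 3 * k) \sum_(0 <= y < 2 * m) f x y <= 2 * k * m.
Proof.
move=> pf; elim: k => [|k IHk]; first by rewrite muln0 big_nil.
rewrite mulnS addnC addn3 !big_nat_recr //= -!addnA -!big_split /=.
suff col: \sum_(0 <= y < 2 * m)
    (f (3 * k) y + (f (3 * k).+1 y + f (3 * k).+2 y)) <= 2 * m by lia.
elim: m {IHk} => [|m IHm]; first by rewrite muln0 big_nil.
rewrite mulnS addnC addn2 !big_nat_recr //=.
(* A 3 x 2 block is the union of the upward triangle at (3k, 2m) and the downward one at (3k + 1,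
   2m). *)
have [] := pf (3 * k) (2 * m); have [] := pf (3 * k).+1 (2 * m); lia.
Qed.

(** [u] bounds the doubled sum, since the bound k(3k + 1)/2 for T_(3k) is kept free of division; 4km
    is twice the rhombus bound. *)
Lemma triangle_sum_step f k m u v : triangle_packing f ->
  (forall g, triangle_packing g -> 2 * triangle_sum g (3 * k) <= u) ->
  (forall g, triangle_packing g -> triangle_sum g (2 * m) <= v) ->
  2 * triangle_sum f (3 * k + 2 * m) <= u + 2 * v + 4 * k * m.
Proof.
move=> pf Hu Hv; rewrite triangle_sum_split.
have : 2 * triangle_sum (fun x y => f x (2 * m + y)) (3 * k) <= u.
  exact: (Hu _ (triangle_packing_shift _ 0 (2 * m) pf)).
have : triangle_sum (fun x y => f (3 * k + x) y) (2 * m) <= v.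
  exact: (Hv _ (triangle_packing_shift _ (3 * k) 0 pf)).
have := rhombus_sum_le f k m pf; lia.
Qed.

(** * Small triangles *)

Lemma triangle_sum1 f : triangle_packing f -> triangle_sum f 1 <= 1.
Proof. by move=> pf; rewrite /triangle_sum unlock /=; have [] := pf 0 0; lia. Qed.

Lemma triangle_sum2 f : triangle_packing f -> triangle_sum f 2 <= 1.
Proof. by move=> pf; rewrite /triangle_sum unlock /=; have [] := pf 0 0; lia. Qed.

(* In the small cases below the triangles used cover T_n; some of them stick out
   of it, which is harmless because [f] is constrained on all of nat * nat. *)
Lemma triangle_sum3 f : triangle_packing f -> triangle_sum f 3 <= 3.
Proof.
move=> pf; rewrite /triangle_sum unlock /=.
have [U00 _] := pf 0 0; have [_ D01] := pf 0 1; have [U20 _] := pf 2 0; lia.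
Qed.

Lemma triangle_sum4 f : triangle_packing f -> triangle_sum f 4 <= 4.
Proof.
move=> pf; rewrite /triangle_sum unlock /=.
have [U00 _] := pf 0 0; have [_ D01] := pf 0 1.
have [U03 _] := pf 0 3; have [U20 _] := pf 2 0; lia.
Qed.

(* Fifteen triangles (each corner one counted twice) cover every point of T_6
   at least twice, so twice the sum is at most 15. *)
Lemma triangle_sum6 f : triangle_packing f -> triangle_sum f 6 <= 7.
Proof.
move=> pf; rewrite /triangle_sum unlock /=.
have [U00 _] := pf 0 0; have [U40 _] := pf 4 0; have [U04 _] := pf 0 4.
have [_ D12] := pf 1 2; have [_ D21] := pf 2 1; have [_ D20] := pf 2 0.
have [_ D10] := pf 1 0; have [_ D01] := pf 0 1.
have [U02 D02] := pf 0 2; have [U20 _] := pf 2 0; have [U22 _] := pf 2 2.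
lia.
Qed.

(** Ten triangles cover the 28 points of T_7, only (2, 3) and (3, 2) twice. *)
Lemma triangle_sum7 f : triangle_packing f -> triangle_sum f 7 <= 10.
Proof.
move=> pf; rewrite /triangle_sum unlock /=.
have [U00 _] := pf 0 0; have [_ D01] := pf 0 1; have [U03 _] := pf 0 3.
have [U05 _] := pf 0 5; have [_ D13] := pf 1 3; have [U20 _] := pf 2 0.
have [U22 _] := pf 2 2; have [_ D30] := pf 3 0; have [U32 _] := pf 3 2.
have [U50 _] := pf 5 0; lia.
Qed.

(** Fifteen triangles tile the 45 points of T_9 exactly. *)
Lemma triangle_sum9 f : triangle_packing f -> triangle_sum f 9 <= 15.
Proof.
move=> pf; rewrite /triangle_sum unlock /=.
have [U00 _] := pf 0 0; have [_ D01] := pf 0 1; have [U03 _] := pf 0 3.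
have [U05 _] := pf 0 5; have [U07 _] := pf 0 7; have [_ D13] := pf 1 3.
have [_ D15] := pf 1 5; have [U20 _] := pf 2 0; have [_ D21] := pf 2 1.
have [_ D32] := pf 3 2; have [U34 _] := pf 3 4; have [U40 _] := pf 4 0.
have [_ D50] := pf 5 0; have [U52 _] := pf 5 2; have [U70 _] := pf 7 0.
lia.
Qed.

(** * Upper bounds for general T_n *)

Lemma triangle_sum5 f : triangle_packing f -> triangle_sum f 5 <= 6.
Proof.
move=> pf; rewrite -(leq_pmul2l (isT : 0 < 2)).
(* T_5 splits into T_3, T_2 and a 3 x 2 rhombus: 3 + 1 + 2 = 6. The argument 6 is the doubled bound
   for T_3. *)
apply: (triangle_sum_step f 1 1 6 1 pf _ triangle_sum2) => g pg.
exact: (@leq_mul 2 _ 2 3 isT (triangle_sum3 _ pg)).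
Qed.

(** The three corners of T_3 beat the value 2 that k = 1 would give. For k >= 4 the induction goes
    down by 2 and so never meets k = 1. *)
Lemma triangle_sum_mult3 k f : k != 1 -> triangle_packing f ->
  2 * triangle_sum f (3 * k) <= k * (3 * k + 1).
Proof.
elim/ltn_ind: k f => k IH f k1 pf.
case: k => [|[|[|[|k]]]] in IH k1 *; rewrite ?muln0 //.
- by rewrite /triangle_sum big_nil.
- by have : triangle_sum f (3 * 2) <= 7 := triangle_sum6 _ pf; lia.
- by have : triangle_sum f (3 * 3) <= 15 := triangle_sum9 _ pf; lia.
have -> : 3 * k.+4 = 3 * k.+2 + 2 * 3 by lia.
have H g : triangle_packing g ->
    2 * triangle_sum g (3 * k.+2) <= k.+2 * (3 * k.+2 + 1) by apply: IH.
by have := triangle_sum_step _ _ 3 _ _ pf H triangle_sum6; lia.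
Qed.

(** Since n(n + 1) is 0 or 2 mod 6, this bounds the sum by the ceiling of n(n + 1)/6. *)
Lemma triangle_sum_bound n f : triangle_packing f -> n != 3 -> n != 5 ->
  6 * triangle_sum f n <= n * n.+1 + 4.
Proof.
move=> pf n3 n5.
have H k : k != 1 -> forall g, triangle_packing g ->
    2 * triangle_sum g (3 * k) <= k * (3 * k + 1).
  by move=> k1 g; apply: triangle_sum_mult3.
have [k [En|[En|En]]] : exists k, n = 3 * k \/ n = 3 * k + 2 * 1 \/ n = 3 * k + 1.
  by exists (n %/ 3); lia.
- have k1 : k != 1 by lia.
  by rewrite En; have := H k k1 f pf; lia.
- have k1 : k != 1 by lia.
  by rewrite En; have := triangle_sum_step _ _ 1 _ _ pf (H k k1) triangle_sum2; lia.
case: k => [|k] in En.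
  by rewrite En; have : triangle_sum f (3 * 0 + 1) <= 1 := triangle_sum1 _ pf; lia.
(* Now n = 3k + 4. For k = 1 the splitting into T_3 and T_4 would only give 3 + 4 + 4 = 11. *)
have [k1|k1] := eqVneq k 1.
  rewrite En k1.
  by have : triangle_sum f (3 * 2 + 1) <= 10 := triangle_sum7 _ pf; lia.
have -> : n = 3 * k + 2 * 2 by lia.
by have := triangle_sum_step _ _ 2 _ _ pf (H k k1) triangle_sum4; lia.
Qed.

(** * Coordinates and adjacency on the simplex *)

Definition o0 : 'I_3 := @Ordinal 3 0 isT.
Definition o1 : 'I_3 := @Ordinal 3 1 isT.
Definition o2 : 'I_3 := @Ordinal 3 2 isT.

Lemma forall_ord3 (P : 'I_3 -> Prop) : P o0 -> P o1 -> P o2 -> forall i, P i.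
Proof.
move=> P0 P1 P2 [[|[|[|//]]] lti].
- by rewrite (_ : Ordinal lti = o0) //; apply: val_inj.
- by rewrite (_ : Ordinal lti = o1) //; apply: val_inj.
- by rewrite (_ : Ordinal lti = o2) //; apply: val_inj.
Qed.

Lemma big_ord3 (F : 'I_3 -> nat) : \sum_i F i = F o0 + F o1 + F o2.
Proof.
rewrite !big_ord_recl big_ord0 addn0 addnA.
by congr (F _ + F _ + F _); apply: val_inj.
Qed.

Lemma simplex3_sum d (a : simplex 3 d) : val a o0 + val a o1 + val a o2 = d.
Proof. by rewrite -(big_ord3 (fun i => val a i : nat)); apply/eqP/(valP a). Qed.

Lemma simplex3_eq d (a b : simplex 3 d) :
  val a o0 = val b o0 :> nat -> val a o1 = val b o1 :> nat -> a = b.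
Proof.
move=> e0 e1; have e2 : val a o2 = val b o2 :> nat.
  by have := simplex3_sum _ a; have := simplex3_sum _ b; lia.
by apply/val_inj/ffunP; apply: forall_ord3; apply: val_inj.
Qed.

Lemma simplex3_exists d x y : x + y <= d ->
  exists a : simplex 3 d, val a o0 = x :> nat /\ val a o1 = y :> nat.
Proof.
move=> le; pose g : {ffun 'I_3 -> 'I_d.+1} :=
  [ffun i : 'I_3 => inord (nth 0 [:: x; y; d - x - y] i)].
have g0 : g o0 = x :> nat by rewrite ffunE /= inordK //; lia.
have g1 : g o1 = y :> nat by rewrite ffunE /= inordK //; lia.
have g2 : g o2 = d - x - y :> nat by rewrite ffunE /= inordK //; lia.
have gP : \sum_(i < 3) g i == d by rewrite big_ord3 g0 g1 g2; lia.
by exists (Sub g gP); rewrite SubK.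
Qed.

(** Moving the subtracted terms across turns the vector equation into equations between natural
    numbers. *)
Lemma adjP q d (a b : simplex q d) :
  reflect (exists i j, i != j /\
             forall k, val a k + (k == j) = val b k + (k == i))
          (adj a b).
Proof.
have E i j : (vec a - vec b == unit_vec i - unit_vec j)%R <->
    forall k, val a k + (k == j) = val b k + (k == i).
  split=> [/eqP /rowP H k | H].
    by have := H k; rewrite !mxE !eqxx /=; do 2!case: eqP => _; lia.
  apply/eqP/rowP => k; have := H k; rewrite !mxE !eqxx /=.
  by do 2!case: eqP => _; lia.
apply: (iffP idP) => [/andP[_ /existsP[i /existsP[j /andP[nij /E H]]]]|].
  by exists i, j.
case=> i [j [nij H]]; apply/andP; split.
  by apply/eqP => ab; have := H i; rewrite ab eqxx (negbTE nij); lia.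
by apply/existsP; exists i; apply/existsP; exists j; rewrite nij; apply/E.
Qed.

(** The disjuncts are the six ordered pairs (i, j), read in the first two coordinates; the third is
    fixed by the sum. *)
Lemma adj3E d (a b : simplex 3 d) :
  let x := val a o0 : nat in let y := val a o1 : nat in
  let u := val b o0 : nat in let v := val b o1 : nat in
  adj a b = [|| (x == u.+1) && (y == v), (u == x.+1) && (y == v),
                (y == v.+1) && (x == u), (v == y.+1) && (x == u),
                (x == u.+1) && (v == y.+1) | (u == x.+1) && (y == v.+1)].
Proof.
move=> x y u v; have sa := simplex3_sum _ a; have sb := simplex3_sum _ b.
apply/adjP/idP => [[i [j [nij H]]]|].
  have := H o2; have := H o1; have := H o0; clear H.
  move: nij; rewrite -/x -/y -/u -/v in sa sb *.
  by elim/forall_ord3: i; elim/forall_ord3: j => //= _; lia.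
pose z := val a o2 : nat; pose w := val b o2 : nat.
rewrite -/x -/y -/z -/u -/v -/w in sa sb.
have adjI i j : [&& x + (o0 == j) == u + (o0 == i),
                    y + (o1 == j) == v + (o1 == i) &
                    z + (o2 == j) == w + (o2 == i)] ->
    forall k, val a k + (k == j) = val b k + (k == i).
  by case/and3P => e0 e1 e2; elim/forall_ord3; apply/eqP.
case/orP => [H|]; first by exists o0, o2; split=> //; apply: adjI => /=; lia.
case/orP => [H|]; first by exists o2, o0; split=> //; apply: adjI => /=; lia.
case/orP => [H|]; first by exists o1, o2; split=> //; apply: adjI => /=; lia.
case/orP => [H|]; first by exists o2, o1; split=> //; apply: adjI => /=; lia.
case/orP => [H|H]; first by exists o0, o1; split=> //; apply: adjI => /=; lia.
by exists o1, o0; split=> //; apply: adjI => /=; lia.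
Qed.

(** * Independent sets as packings *)

Definition occupied d (A : {set simplex 3 d}) (x y : nat) : bool :=
  [exists a in A, (val a o0 == x :> nat) && (val a o1 == y :> nat)].

Lemma card_occupied d (A : {set simplex 3 d}) :
  #|A| = triangle_sum (fun x y => occupied d A x y) d.+1.
Proof.
have fiber x y :
    \sum_(a in A | (val a o0 == x :> nat) && (val a o1 == y :> nat)) 1 =
    occupied d A x y.
  rewrite /occupied; case: exists_inP => [[a aA /andP[/eqP ax /eqP ay]] | nex].
    rewrite (big_pred1 a) // => b.
    apply/andP/eqP => [[_ /andP[/eqP bx /eqP by_]] | ->].
      by apply: simplex3_eq; rewrite ?ax ?ay.
    by rewrite aA ax ay !eqxx.
  by rewrite big_pred0 // => a; apply/negP => /andP[aA H]; apply: nex; exists a.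
rewrite -sum1_card (partition_big (fun a : simplex 3 d => val a o0) xpredT) //=.
rewrite /triangle_sum big_mkord; apply: eq_bigr => x _.
rewrite (partition_big (fun a : simplex 3 d => val a o1) xpredT) //=.
have lex : d.+1 - x <= d.+1 by lia.
transitivity (\sum_(0 <= y < d.+1) occupied d A x y).
  rewrite big_mkord; apply: eq_bigr => y _; rewrite -fiber.
  by apply: eq_bigl => a; rewrite -andbA.
(* The terms with x + y > d vanish, so the inner range can be cut at d + 1 - x. *)
rewrite (big_cat_nat _ lex) //= [X in _ + X]big_nat_cond [X in _ + X]big1 ?addn0 //.
move=> y /andP[/andP[ley _] _]; apply/eqP; rewrite eqb0.
apply/exists_inP => -[a _ /andP[/eqP ax /eqP ay]].
by have := simplex3_sum _ a; lia.
Qed.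

Lemma occupied_packing d (A : {set simplex 3 d}) :
  independent (@adj 3 d) A -> triangle_packing (fun x y => occupied d A x y).
Proof.
move=> /forall_inP indA.
have excl x y u v :
    [|| (x == u.+1) && (y == v), (u == x.+1) && (y == v),
        (y == v.+1) && (x == u), (v == y.+1) && (x == u),
        (x == u.+1) && (v == y.+1) | (u == x.+1) && (y == v.+1)] ->
    occupied d A x y + occupied d A u v <= 1.
  move=> xyuv; case oxy: (occupied d A x y); last by case: occupied.
  case ouv: (occupied d A u v) => //.
  have /exists_inP[a aA /andP[/eqP ax /eqP ay]] := oxy.
  have /exists_inP[b bA /andP[/eqP bx /eqP by_]] := ouv.
  have := forall_inP (indA a aA) b bA.
  by rewrite adj3E ax ay bx by_ xyuv.
move=> x y.
(* The two triangles share an edge, hence five pairs; adding the three pair bounds of a triangle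
   gives at most 3/2, so at most 1. *)
have := excl x y x.+1 y ltac:(lia); have := excl x y x y.+1 ltac:(lia).
have := excl x.+1 y x y.+1 ltac:(lia); have := excl x.+1 y x.+1 y.+1 ltac:(lia).
by have := excl x y.+1 x.+1 y.+1 ltac:(lia); lia.
Qed.

(** * Bounds on the independence number *)

Lemma independence_number_ge (T : finType) (e : rel T) (A : {set T}) :
  independent e A -> #|A| <= independence_number e.
Proof. exact: (leq_bigmax_cond A). Qed.

(** The hypotheses forbid the three edge directions, so the points of the simplex above [Q] are
    independent. *)
Lemma triangle_sum_le_alpha d (Q : nat -> nat -> bool) :
  (forall x y, ~~ (Q x y && Q x.+1 y)) -> (forall x y, ~~ (Q x y && Q x y.+1)) ->
  (forall x y, ~~ (Q x.+1 y && Q x y.+1)) ->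
  triangle_sum (fun x y => Q x y) d.+1 <= alpha 3 d.
Proof.
move=> Q1 Q2 Q3; pose A := [set a : simplex 3 d | Q (val a o0) (val a o1)].
have indA : independent (@adj 3 d) A.
  apply/forall_inP => a; rewrite inE => Qa.
  apply/forall_inP => b; rewrite inE => Qb.
  apply/negP; rewrite adj3E => H; move: Qa Qb.
  move: (val a o0 : nat) (val a o1 : nat) H => x y.
  move: (val b o0 : nat) (val b o1 : nat) => u v H Qa Qb.
  move: H; do 5?[case/orP]; case/andP => /eqP Ex /eqP Ey; subst.
  - by have := Q1 u v; rewrite Qa Qb.
  - by have := Q1 x v; rewrite Qa Qb.
  - by have := Q2 u v; rewrite Qa Qb.
  - by have := Q2 u y; rewrite Qa Qb.
  - by have := Q3 u y; rewrite Qa Qb.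
  - by have := Q3 x v; rewrite Qa Qb.
apply: leq_trans (independence_number_ge _ _ _ indA).
rewrite card_occupied /triangle_sum.
rewrite big_nat [leqRHS]big_nat; apply: leq_sum => x /andP[_ ltx].
rewrite big_nat [leqRHS]big_nat; apply: leq_sum => y /andP[_ lty].
case Qxy: (Q x y) => //; rewrite lt0b; apply/exists_inP.
have [|a [ax ay]] := simplex3_exists d x y; first by lia.
by exists a; rewrite ?inE ax ay ?eqxx.
Qed.

Lemma alpha3_le d v :
  (forall f, triangle_packing f -> triangle_sum f d.+1 <= v) -> alpha 3 d <= v.
Proof.
move=> H; apply/bigmax_leqP => A indA.
by rewrite card_occupied; apply/H/occupied_packing.
Qed.

(** Induction by splitting off the column x = 0, which has n + 1 points. *)
Lemma triangle_sum_const1 n : 2 * triangle_sum (fun _ _ => 1) n = n * n.+1.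
Proof.
elim: n => [|n IHn]; first by rewrite /triangle_sum big_nil.
have := triangle_sum_split (fun _ _ => 1) 1 n.
have -> : triangle_sum (fun _ _ => 1) 1 = 1 by rewrite /triangle_sum !big_nat1.
by rewrite add1n big_nat1 sum_nat_const_nat; lia.
Qed.

(** Along any edge x + 2y changes by a nonzero amount mod 3; adding the bounds for the three classes
    counts all of T_(d+1). *)
Lemma alpha3_ge d : d.+1 * d.+2 <= 6 * alpha 3 d.
Proof.
pose Q c x y := (x + 2 * y) %% 3 == c.
have H c : triangle_sum (fun x y => Q c x y) d.+1 <= alpha 3 d.
  by apply: triangle_sum_le_alpha => x y; rewrite /Q; apply/negP; lia.
have S : triangle_sum (fun _ _ => 1) d.+1 =
    triangle_sum (fun x y => Q 0 x y) d.+1 +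
    triangle_sum (fun x y => Q 1 x y) d.+1 +
    triangle_sum (fun x y => Q 2 x y) d.+1.
  rewrite /triangle_sum -!big_split /=; apply: eq_bigr => x _.
  rewrite -!big_split /=; apply: eq_bigr => y _; rewrite /Q; lia.
have := triangle_sum_const1 d.+1; have := H 0; have := H 1; have := H 2; lia.
Qed.

Lemma alpha3_ge_even d :
  triangle_sum (fun x y => ~~ odd x && ~~ odd y) d.+1 <= alpha 3 d.
Proof.
pose Q x y := ~~ odd x && ~~ odd y.
by apply: (triangle_sum_le_alpha d Q) => x y; rewrite /Q; lia.
Qed.

(** * The closed formula *)

Local Open Scope ring_scope.

Theorem theorem4p2 (d : nat) (hd : (1 <= d)%N) :
  (alpha 3 d)%:Z =
    if d == 2%N then 3
    else if d == 4%N then 6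
    else Num.ceil (((d + 1) * (d + 2))%N%:R / 6%:R : rat).
Proof.
have [-> | d2] := eqVneq d 2%N.
  congr Posz; apply/eqP; rewrite eqn_leq alpha3_le; last exact: triangle_sum3.
  by apply: leq_trans (alpha3_ge_even 2); rewrite /triangle_sum unlock.
have [-> | d4] := eqVneq d 4%N.
  congr Posz; apply/eqP; rewrite eqn_leq alpha3_le.
    by apply: leq_trans (alpha3_ge_even 4); rewrite /triangle_sum unlock.
  exact: triangle_sum5.
have ub : (6 * alpha 3 d <= d.+1 * d.+2 + 4)%N.
  have: (alpha 3 d <= (d.+1 * d.+2 + 4) %/ 6)%N.
    apply: alpha3_le => f pf; rewrite leq_divRL // mulnC.
    by apply: triangle_sum_bound.
  by rewrite leq_divRL // mulnC.
have lb := alpha3_ge d.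
(* With N = (d + 1)(d + 2), the ceiling condition is 6(alpha - 1) < N <= 6 alpha; the slack 4 in
   [ub] is below 6. *)
symmetry; apply: ceil_def; rewrite ltr_pdivlMr // ler_pdivrMr //.
rewrite addn1 addn2 rmorphB /= -!pmulrn mulrBl mul1r.
rewrite -!natrM ltrBlDr -natrD ltr_nat ler_nat; lia.
Qed.
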